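(* Let $D\subseteq\mathbb{R}^d$, let $K:D\times D\to\mathbb{R}$ be a covariance function, and let $\mathbf{x}^1,\dots,\mathbf{x}^k\in D$ be $k$ different locations such that the $k\times k$ matrix $\mathbf{C}_Z=(K(\mathbf{x}^i,\mathbf{x}^j))_{1\le i,j\le k}$ is invertible. Let $\mathbf{Z}=(Z(\mathbf{x}^1),\dots,Z(\mathbf{x}^k))$ be a Gaussian random vector with mean $\boldsymbol{\mu}_Z=(\mu_{Z_1},\dots,\mu_{Z_k})^\top$ and covariance matrix $\boldsymbol{\Gamma}_Z$ whose diagonal entries are $\sigma^2_{Z_1},\dots,\sigma^2_{Z_k}$. Then the distribution-wise Gaussian process built from $\mathbf{Z}$ interpolates the means and variances of the distributions at the $k$ locations: for all $i=1,\dots,k$, $$m^{Dist}(\mathbf{x}^i)=\mu_{Z_i}\quad\text{and}\quad v^{Dist}(\mathbf{x}^i)=\sigma^2_{Z_i}.$$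
   Context: A covariance function is a symmetric positive semidefinite kernel. For $\mathbf{x}\in D$, let $\mathbf{c}_Z(\mathbf{x})=(K(\mathbf{x},\mathbf{x}^1),\dots,K(\mathbf{x},\mathbf{x}^k))^\top$. The distribution-wise Gaussian process has conditional mean and variance obtained by first conditioning the zero-mean Gaussian process $Y$ with kernel $K$ on $Y(\mathbf{x}^i)=Z(\mathbf{x}^i)$, $1\le i\le k$, and then applying the laws of total expectation and total variance over $\mathbf{Z}$; that is, $$m^{Dist}(\mathbf{x})=\mathbf{c}_Z(\mathbf{x})^\top\mathbf{C}_Z^{-1}\boldsymbol{\mu}_Z,$$ $$v^{Dist}(\mathbf{x})=K(\mathbf{x},\mathbf{x})-\mathbf{c}_Z(\mathbf{x})^\top\mathbf{C}_Z^{-1}\mathbf{c}_Z(\mathbf{x})+\mathbf{c}_Z(\mathbf{x})^\top\mathbf{C}_Z^{-1}\boldsymbol{\Gamma}_Z\mathbf{C}_Z^{-1}\mathbf{c}_Z(\mathbf{x}).$$ *)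

(* Defs.v *)
From HB Require Import structures.
From mathcomp Require Import all_boot all_order all_algebra.
From mathcomp Require Import all_classical all_reals all_analysis.

Set Implicit Arguments.
Unset Strict Implicit.
Unset Printing Implicit Defensive.

Import Order.TTheory GRing.Theory Num.Theory.

Local Open Scope classical_set_scope.
Local Open Scope ring_scope.

Definition covariance_function (R : realType) (E : Type) (K : E -> E -> R) :
    Prop :=
  (forall x y, K x y = K y x) /\
  (forall (n : nat) (x : 'I_n -> E) (a : 'I_n -> R),
     0 <= \sum_(i < n) \sum_(j < n) a i * a j * K (x i) (x j)).

(* [normal_prob m 0] is by convention the uniform law on [0, 1], so the
   degenerate Gaussian law (standard deviation 0) is taken to be the Dirac
   mass at the mean. *)
Definition gaussian_law (R : realType) (m s : R) (A : set R) : \bar R :=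
  if s == 0 then \d_m A else normal_prob m s A.

(* Every linear combination of the components has a univariate, possibly
   degenerate, Gaussian law. *)
Definition gaussian_vector (disp : measure_display) (T : measurableType disp)
    (R : realType) (P : probability T R) (k : nat)
    (Z : 'I_k -> {RV P >-> R}) : Prop :=
  forall a : 'I_k -> R, exists m s : R, forall A : set R, measurable A ->
    pushforward P (fun w => \sum_(i < k) a i * Z i w) A = gaussian_law m s A.

Definition covariance_matrix (R : realType) (E : Type) (K : E -> E -> R)
    (k : nat) (xs : 'I_k -> E) : 'M[R]_k :=
  \matrix_(i < k, j < k) K (xs i) (xs j).

Definition covariance_vector (R : realType) (E : Type) (K : E -> E -> R)
    (k : nat) (xs : 'I_k -> E) (x : E) : 'cV[R]_k :=
  \col_(i < k) K x (xs i).

(* In the next two definitions, the entry [0 0] reads a 1 x 1 matrix as a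
   scalar. *)
Definition mean_dist (R : realType) (E : Type) (K : E -> E -> R)
    (k : nat) (xs : 'I_k -> E) (mu : 'cV[R]_k) (x : E) : R :=
  let C := covariance_matrix K xs in
  let c := covariance_vector K xs x in
  (c^T *m invmx C *m mu) 0 0.

Definition var_dist (R : realType) (E : Type) (K : E -> E -> R)
    (k : nat) (xs : 'I_k -> E) (Gamma : 'M[R]_k) (x : E) : R :=
  let C := covariance_matrix K xs in
  let c := covariance_vector K xs x in
  K x x - (c^T *m invmx C *m c) 0 0
    + (c^T *m invmx C *m Gamma *m invmx C *m c) 0 0.

(* Main.v *)
Require Import Defs.
From HB Require Import structures.
From mathcomp Require Import all_boot all_order all_algebra.
From mathcomp Require Import all_classical all_reals all_analysis.

Set Implicit Arguments.
Unset Strict Implicit.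
Unset Printing Implicit Defensive.

Import Order.TTheory GRing.Theory Num.Theory.

Local Open Scope classical_set_scope.
Local Open Scope ring_scope.

(** At a data site the covariance vector is the [i]-th row of the covariance
    matrix [C], hence, by symmetry of the kernel, also its [i]-th column.
    Multiplying it by the inverse of [C] therefore yields the [i]-th unit
    vector ([tr_covariance_vector_inv], [inv_covariance_vector]).  The mean
    thus reads off the [i]-th entry of [mu]; in the variance the quadratic form
    of the inverse of [C] collapses to [K (xs i) (xs i)], which cancels the
    prior variance, and the correction term is the [i]-th diagonal entry of
    [Gamma]. *)

Section DataSite.
Variables (R : realType) (E : Type) (K : E -> E -> R) (k : nat).
Variables (xs : 'I_k -> E) (i : 'I_k).

Local Notation C := (covariance_matrix K xs).
Local Notation c := (covariance_vector K xs (xs i)).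

Lemma tr_covariance_vector_site : c^T = row i C.
Proof. by apply/rowP => j; rewrite !mxE. Qed.

Lemma covariance_vector_site : (forall x y, K x y = K y x) -> c = col i C.
Proof. by move=> symK; apply/colP => j; rewrite !mxE symK. Qed.

Hypothesis C_unit : C \in unitmx.

Lemma tr_covariance_vector_inv : c^T *m invmx C = delta_mx 0 i.
Proof. by rewrite tr_covariance_vector_site rowE mulmxK. Qed.

Lemma inv_covariance_vector :
  (forall x y, K x y = K y x) -> invmx C *m c = delta_mx i 0.
Proof. by move=> symK; rewrite covariance_vector_site // colE mulKmx. Qed.

Lemma mean_dist_site (mu : 'cV[R]_k) : mean_dist K xs mu (xs i) = mu i 0.
Proof. by rewrite /mean_dist tr_covariance_vector_inv -rowE mxE. Qed.

Lemma var_dist_site (Gamma : 'M[R]_k) :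
  (forall x y, K x y = K y x) -> var_dist K xs Gamma (xs i) = Gamma i i.
Proof.
move=> symK; rewrite /var_dist tr_covariance_vector_inv.
rewrite -(mulmxA _ (invmx C)) inv_covariance_vector //.
by rewrite -!rowE -colE !mxE subrr add0r.
Qed.

End DataSite.

Theorem mainTheorem4 (R : realType) (d : nat) (D : set 'rV[R]_d)
    (K : D -> D -> R) (hK : covariance_function K)
    (k : nat) (xs : 'I_k -> D) (hxs : injective xs)
    (hC : covariance_matrix K xs \in unitmx)
    (disp : measure_display) (T : measurableType disp) (P : probability T R)
    (Z : 'I_k -> {RV P >-> R}) (hZ : gaussian_vector Z)
    (mu : 'cV[R]_k) (Gamma : 'M[R]_k) (sigma2 : 'I_k -> R)
    (hmu : forall i : 'I_k, ('E_P[Z i] = (mu i 0)%:E)%E)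
    (hGamma : forall i j : 'I_k, covariance P (Z i) (Z j) = (Gamma i j)%:E)
    (hsigma2 : forall i : 'I_k, Gamma i i = sigma2 i) :
  forall i : 'I_k,
    mean_dist K xs mu (xs i) = mu i 0 /\
    var_dist K xs Gamma (xs i) = sigma2 i.
Proof.
move=> i; split; first exact: mean_dist_site.
rewrite -hsigma2; apply: var_dist_site => //; exact: hK.1.
Qed.
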